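(* Let $\beta>1$ be a cubic Pisot unit with a pair of complex (non-real) Galois conjugates $\alpha,\bar\alpha$, and let $E=\{\lfloor\beta^i\rceil : i\in\mathbb N_0\}$. Then the characteristic word $\mathbf 1_E$ is a bracket word.
   Context: $\mathbb N_0=\{0,1,2,\dots\}$. $\lfloor x\rceil=\lfloor x+1/2\rfloor$ denotes the nearest integer. A Pisot number is a real algebraic integer $\beta>1$ all of whose Galois conjugates (other than $\beta$ itself) have absolute value strictly less than $1$; a cubic Pisot unit is a Pisot number of degree $3$ over $\mathbb Q$ that is a unit in the ring of algebraic integers. For $E\subset\mathbb N_0$, $\mathbf 1_E\in\{0,1\}^\infty$ is the word with $(\mathbf 1_E)_n=1$ if $n\in E$ and $0$ otherwise. Generalised polynomial (GP) maps $\mathbb R\to\mathbb R$ form the smallest family of maps that contains all polynomial maps $\mathbb R\to\mathbb R$, is closed under sums and products, and contains $\lfloor g\rfloor$ whenever it contains $g$. A GP map $\mathbb N_0\to\mathbb R$ is the restriction to $\mathbb N_0$ of such a map. A bracket word over a finite alphabet $\Sigma$ is an infinite word $\mathbf a=(a_n)_{n=0}^\infty\in\Sigma^\infty$ of the form $a_n=c(g(n))$ for all $n\in\mathbb N_0$, where $g\colon\mathbb N_0\to\mathbb R$ is a finitely-valued GP map and $c\colon g(\mathbb N_0)\to\Sigma$ is an arbitrary map. *)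

(* Defs.v *)
From HB Require Import structures.
From mathcomp Require Import all_boot all_order all_algebra.
From mathcomp Require Import complex.
From mathcomp Require Import all_classical all_reals all_analysis.

Set Implicit Arguments.
Unset Strict Implicit.
Unset Printing Implicit Defensive.

Import Order.TTheory GRing.Theory Num.Theory.

Local Open Scope classical_set_scope.
Local Open Scope ring_scope.
Local Open Scope complex_scope.

Definition is_minimal_polynomial (F : fieldType) (p : {poly rat}) (x : F) :=
  [/\ p \is monic, irreducible_poly p & root (map_poly ratr p) x].

Definition galois_conjugate (R : realType) (beta : R) (z : R[i]) :=
  exists2 p : {poly rat},
    is_minimal_polynomial p beta & root (map_poly ratr p) z.

Definition algebraic_integer (R : realType) (x : R) :=
  integralOver (intr : int -> R) x.

Definition has_degree_over_Q (R : realType) (x : R) (d : nat) :=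
  exists2 p : {poly rat}, is_minimal_polynomial p x & size p = d.+1.

Definition pisot_number (R : realType) (beta : R) :=
  [/\ 1 < beta, algebraic_integer beta
    & forall z : R[i],
        galois_conjugate beta z -> z != beta%:C -> `|z| < 1].

Definition cubic_pisot_unit (R : realType) (beta : R) :=
  [/\ pisot_number beta, has_degree_over_Q beta 3
    & algebraic_integer beta^-1].

Definition nearest_int (R : realType) (x : R) : int := Num.floor (x + 2^-1).

Inductive gp_map (R : realType) : (R -> R) -> Prop :=
| gp_map_poly (p : {poly R}) : gp_map (fun x => p.[x])
| gp_map_add (f g : R -> R) :
    gp_map f -> gp_map g -> gp_map (fun x => f x + g x)
| gp_map_mul (f g : R -> R) :
    gp_map f -> gp_map g -> gp_map (fun x => f x * g x)
| gp_map_floor (g : R -> R) :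
    gp_map g -> gp_map (fun x => (Num.floor (g x))%:~R).

Definition gp_map_nat (R : realType) (u : nat -> R) :=
  exists2 g : R -> R, gp_map g & forall n, u n = g n%:R.

(* Only the values of [c] on [range g] matter; since [Sigma] is inhabited
   (by [a 0]), any map from [range g] to [Sigma] extends to all of [R]. *)
Definition bracket_word (R : realType) (Sigma : finType) (a : nat -> Sigma) :=
  exists (g : nat -> R) (c : R -> Sigma),
    [/\ gp_map_nat g, finite_set (range g) & forall n, a n = c (g n)].

Definition char_word (E : set nat) : nat -> 'I_2 := \1_E.

(* For [1 < beta] the nearest integers to the powers of [beta] are positive,
   so nothing is lost by restricting to [nat]. *)
Definition nearest_powers (R : realType) (beta : R) : set nat :=
  [set n | exists i : nat, nearest_int (beta ^+ i) = n%:Z].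

(* Main.v *)
Require Import Defs.
From mathcomp Require Import all_boot all_order all_algebra.
From mathcomp Require Import complex.
From mathcomp Require Import all_classical all_reals all_analysis.
From mathcomp Require Import ring lra zify.
Import Order.TTheory GRing.Theory Num.Theory.
Local Open Scope ring_scope.
Local Open Scope complex_scope.

(** Write [b] for the Pisot unit, [a] for its non-real conjugate, and [E] for
    the set of nearest integers to the powers of [b].

    As [b] is a unit of degree three, [b * |a|^2 = 1]; hence the powers of [a]
    stay in the unit disc.  If [u = w_0 + w_1 b + w_2 b^2] is an element of
    [Z[b]] whose complex conjugate lies in the unit disc, solving the linear
    system for the coordinates gives [w_i = d_i u + O(1)] with constants [d_i]
    ([coord_approx]).  So when [n] is the integer nearest to some power [b^k],
    the coordinates of [b^k] are [floor (d_i n) + t_i] with [t] in a fixed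
    finite box: every [n] comes with a bounded number of candidates, all with
    generalised polynomial coordinates.

    It remains to recognise the powers of [b] among the candidates [u].  Norm
    one is a polynomial equation in the coordinates ([norm_formE]), and that
    [n] is the integer nearest to [u] is an equation between generalised
    polynomials.  A positive element of norm one need not be a power of [b],
    but the pigeonhole principle gives one exponent [H] such that its [H]-th
    power is ([unit_power]).  There is a modulus [M] such that [H] divides every
    [t] with [b^t = 1] modulo [M Z[b]] ([exists_modulus]).  If [u] is congruent
    to some [b^j] modulo [M] and [u^H = b^l], then [b^(l - j H) = 1] modulo [M],
    so [H] divides [l], and [u] is a power of [b] because it is positive
    ([power_congruence]).  Congruence modulo [M] is a condition on the residues
    of the coordinates.

    All these conditions are combinations of tests [x = 0] on integer-valued
    generalised polynomials [x], and such a test is itself a generalised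
    polynomial: for irrational [theta], the fractional part of [theta x]
    vanishes exactly when [x] does ([gp_test_eq0]).  Thus the indicator of [E]
    is a generalised polynomial with values 0 and 1. *)

(** * The real and complex data of a cubic Pisot unit *)

(** Coordinates are kept apart from their value so that one triple can be
    evaluated both at the real root and at the complex root. *)
Definition quad {T : nzRingType} (w : 'I_3 -> int) (t : T) : T :=
  \sum_i (w i)%:~R * t ^+ i.

Definition sqnorm {R : realType} (z : R[i]) : R :=
  complex.Re z ^+ 2 + complex.Im z ^+ 2.

(** [b], [a] and the conjugate of [a] are the roots of
    [X^3 - s1 X^2 + s2 X - 1], spelled out by Vieta's formulas; [ccu_free] says
    that [b] has degree three over the rationals. *)
Record complex_cubic_unit {R : realType} (b : R) (a : R[i]) (s1 s2 : int)
    : Prop := ComplexCubicUnit {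
  ccu_gt1 : 1 < b;
  ccu_nonreal : complex.Im a != 0;
  ccu_sum : s1%:~R = b + 2 * complex.Re a;
  ccu_sum2 : s2%:~R = 2 * b * complex.Re a + sqnorm a;
  ccu_prod : b * sqnorm a = 1;
  ccu_free : forall w, quad w b = 0 -> forall i, w i = 0 }.

Arguments ccu_gt1 {R b a s1 s2} _.
Arguments ccu_nonreal {R b a s1 s2} _.
Arguments ccu_sum {R b a s1 s2} _.
Arguments ccu_sum2 {R b a s1 s2} _.
Arguments ccu_prod {R b a s1 s2} _.
Arguments ccu_free {R b a s1 s2} _ w.

Lemma map_ratr_intr (F : numFieldType) (q : {poly int}) :
  map_poly (ratr : rat -> F) (map_poly intr q) = map_poly intr q.
Proof.
rewrite -map_poly_comp_id0 ?rmorph0//; apply: eq_map_poly => n /=.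
by rewrite ratr_int.
Qed.

Lemma minimal_polynomial_dvd (F : numFieldType) (p q : {poly rat}) (x : F) :
  is_minimal_polynomial p x -> root (map_poly ratr q) x -> p %| q.
Proof.
move=> [_ p_irr px] qx; apply: contraT => npq.
have := irreducible_poly_coprime q p_irr; rewrite npq /= => cpq.
have : coprimep (map_poly (ratr : rat -> F) p) (map_poly ratr q).
  by rewrite coprimep_map.
by move=> /coprimep_root /(_ px); rewrite -/(root _ _) qx.
Qed.

Lemma minimal_polynomial_uniq (F : numFieldType) (p q : {poly rat}) (x : F) :
  is_minimal_polynomial p x -> is_minimal_polynomial q x -> p = q.
Proof.
move=> hp hq; have [p_mon _ px] := hp; have [q_mon _ qx] := hq.
apply/eqP; rewrite -eqp_monic//.
by rewrite /eqp !(minimal_polynomial_dvd _ _ _ x).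
Qed.

(** Gauss's lemma: the minimal polynomial divides a monic integral one, so its
    primitive integral multiple has leading coefficient 1 or -1. *)
Lemma minimal_polynomial_int (F : numFieldType) (p : {poly rat}) (x : F) :
  is_minimal_polynomial p x -> integralOver (intr : int -> F) x ->
  exists2 P : {poly int}, P \is monic & p = map_poly intr P.
Proof.
move=> hp [q q_mon qx]; have [/monicP p_mon _ _] := hp.
have : p %| map_poly intr q.
  by apply: minimal_polynomial_dvd hp _; rewrite map_ratr_intr.
move=> /dvdpP_rat_int [p1 [a a0 pE] [r qE]].
have l1 : lead_coef p1 * lead_coef r = 1.
  by rewrite -lead_coefM -qE; apply/monicP.
have l2 : lead_coef p1 * lead_coef p1 = 1.
  by move: l1; rewrite mulrC => /intUnitRing.unitzPl /pred2P[->|->].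
exists (lead_coef p1 *: p1).
  by apply/monicP; rewrite lead_coefZ.
have la : a * (lead_coef p1)%:~R = 1.
  rewrite -[RHS]p_mon [in RHS]pE lead_coefZ; congr (_ * _).
  by rewrite lead_coef_map_inj //; exact: (@intr_inj rat).
rewrite pE; rewrite [in LHS](_ : a = (lead_coef p1)%:~R); last first.
  have l2' : (lead_coef p1)%:~R * (lead_coef p1)%:~R = 1 :> rat.
    by rewrite -intrM l2.
  by rewrite -[LHS]mulr1 -[X in _ * X]l2' mulrA la mul1r.
by apply/polyP => i; rewrite coefZ !coef_map /= coefZ rmorphM.
Qed.

(** Turns a monic equation of [x^-1] into an equation of [x] whose constant
    coefficient is 1. *)
Lemma root_reverse (F : fieldType) (q : {poly F}) (x : F) :
  x != 0 -> root q x^-1 -> root (Poly (rev q)) x.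
Proof.
move=> x0 /rootP qx; apply/rootP.
rewrite (@horner_coef_wide _ (size q)); last first.
  by rewrite (leq_trans (size_Poly _))// size_rev.
rewrite (reindex_inj rev_ord_inj) /=.
transitivity (x ^+ (size q).-1 * q.[x^-1]); last by rewrite qx mulr0.
rewrite horner_coef mulr_sumr; apply: eq_bigr => i _.
have hi := ltn_ord i.
have [h1 h2 h3 h4] : [/\ (size q - i.+1 < size q)%N,
    (size q - (size q - i.+1).+1 = i)%N, (size q - i.+1 = (size q).-1 - i)%N
    & (i <= (size q).-1)%N].
  by move: hi; move: (size q) (nat_of_ord i) => m k hkm; split; lia.
rewrite coef_Poly nth_rev// h2 h3 mulrCA; congr (_ * _).
by rewrite exprVn expfB_cond// (negPf x0).
Qed.

(** The reversal of a monic equation of [x^-1] is a multiple of [P] over the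
    integers, again by Gauss's lemma, and its constant coefficient is 1. *)
Lemma minimal_polynomial_unit (F : numFieldType) (P : {poly int}) (x : F) :
  x != 0 -> P \is monic -> is_minimal_polynomial (map_poly intr P) x ->
  integralOver (intr : int -> F) x^-1 -> P`_0 = 1 \/ P`_0 = -1.
Proof.
move=> x0 P_mon hp [q q_mon qx].
have hr : root (map_poly ratr (map_poly (intr : int -> rat) (Poly (rev q)))) x.
  rewrite map_ratr_intr.
  suff -> : map_poly (intr : int -> F) (Poly (rev q)) =
            Poly (rev (map_poly intr q)).
    exact: root_reverse.
  rewrite map_Poly_id0//; congr Poly.
  rewrite map_rev; congr rev; rewrite map_polyE (@PolyK _ (0 : int)%:~R)//.
  by rewrite last_map intr_eq0 -nth_last -lead_coefE lead_coef_eq0 monic_neq0.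
have : map_poly (intr : int -> rat) P %| map_poly intr (Poly (rev q)).
  exact: minimal_polynomial_dvd hp hr.
move=> /dvdpP_rat_int [p1 [a a0 pE] [r qE]].
have al : a * (lead_coef p1)%:~R = 1.
  have /(congr1 lead_coef) := pE; rewrite lead_coefZ.
  have injq := @intr_inj rat.
  by rewrite !lead_coef_map_inj// (monicP P_mon) => <-.
have p1E : p1 = lead_coef p1 *: P.
  apply/polyP => i; rewrite coefZ; apply: (@intr_inj rat); rewrite rmorphM /=.
  have /(congr1 (fun p : {poly rat} => p`_i)) := pE.
  by rewrite coefZ !coef_map /= => ->; rewrite mulrA [_ * a]mulrC al mul1r.
have : P`_0 * (lead_coef p1 * r`_0) = 1.
  rewrite mulrCA mulrA -(coefZ (lead_coef p1) P 0) -p1E -coef0M -qE.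
  rewrite coef_Poly nth_rev.
    by rewrite subn1 -lead_coefE; apply/monicP.
  by rewrite lt0n size_poly_eq0 monic_neq0.
by rewrite mulrC => /intUnitRing.unitzPl /pred2P.
Qed.

Lemma prod3_XsubC (F : comNzRingType) (x y z : F) :
  ('X - x%:P) * (('X - y%:P) * ('X - z%:P)) =
  'X^3 - (x + y + z)%:P * 'X^2 + (x * y + x * z + y * z)%:P * 'X
  - (x * y * z)%:P.
Proof. by rewrite !(rmorphD, rmorphM) /=; ring. Qed.

(** The minimal polynomial has the three distinct roots [beta], [alpha] and
    [alpha^*], hence factors completely.  Its constant coefficient is 1 or -1
    and equals [- beta * |alpha|^2 < 0], which fixes the sign. *)
Lemma cubic_pisot_unit_data (R : realType) (beta : R) (alpha : R[i]) :
  cubic_pisot_unit beta -> galois_conjugate beta alpha ->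
  galois_conjugate beta (alpha^*) -> complex.Im alpha != 0 ->
  exists s1 s2, complex_cubic_unit beta alpha s1 s2.
Proof.
move=> [[b_gt1 b_int _] [p hp sz_p] binv_int] [p' hp' ra] [p'' hp'' ra'] im_a.
have ? := minimal_polynomial_uniq _ _ _ _ hp hp'; subst p'.
have ? := minimal_polynomial_uniq _ _ _ _ hp hp''; subst p'' => {hp' hp''}.
have [P P_mon pE] := minimal_polynomial_int _ _ _ hp b_int; subst p.
have b0 : beta != 0 by rewrite gt_eqF// (lt_trans ltr01).
have P0 := minimal_polynomial_unit _ _ _ b0 P_mon hp binv_int.
have rb : root (map_poly (intr : int -> R) P) beta.
  by case: hp => _ _; rewrite map_ratr_intr.
rewrite map_ratr_intr in ra; rewrite map_ratr_intr in ra'.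
have sz_P (F : numDomainType) : size (map_poly (intr : int -> F) P) = 4%N.
  by rewrite -sz_p !size_map_inj_poly//; exact: intr_inj.
have PE : map_poly (intr : int -> R[i]) P =
   ('X - (beta%:C)%:P) * (('X - alpha%:P) * ('X - (alpha^*)%:P)).
  rewrite [LHS](@all_roots_prod_XsubC _ _ [:: beta%:C; alpha; alpha^*]).
  - rewrite !big_cons big_nil mulr1 lead_coef_map_inj//; last exact: intr_inj.
    by rewrite (monicP P_mon) scale1r.
  - exact: sz_P.
  - rewrite /= ra ra' !andbT.
    have -> : map_poly (intr : int -> R[i]) P =
       map_poly (real_complex R) (map_poly intr P).
      rewrite -map_poly_comp; apply: eq_map_poly => n /=.
      by rewrite rmorph_int.
    by apply/rootP; rewrite horner_map (rootP rb) rmorph0.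
  - rewrite uniq_rootsE /= !inE !andbT.
    case: (alpha) im_a => r s /= s0; rewrite !eq_complex /= !negb_and.
    rewrite [0 == s]eq_sym  [0 == - s]eq_sym oppr_eq0.
    by rewrite (negPf s0) !andbF /= eqxx -addr_eq0 -mulr2n mulrn_eq0 s0.
rewrite prod3_XsubC in PE.
have c0 := congr1 (fun p : {poly R[i]} => p`_0) PE.
have c1 := congr1 (fun p : {poly R[i]} => p`_1) PE.
have c2 := congr1 (fun p : {poly R[i]} => p`_2) PE.
rewrite !(coef_map, coefE) /= in c0 c1 c2.
have intrC n : n%:~R = (n%:~R : R)%:C by rewrite rmorph_int.
rewrite !intrC {intrC PE ra ra'} in c0 c1 c2.
case: alpha im_a c0 c1 c2 => r s /= s0 c0 c1 c2.
have := congr1 (@complex.Re R) c0; have := congr1 (@complex.Re R) c1.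
have := congr1 (@complex.Re R) c2 => /= {c0 c1 c2} c2 c1 c0.
have n0 : 0 < beta * (r ^+ 2 + s ^+ 2).
  have s2 : 0 < s ^+ 2 by rewrite exprn_even_gt0.
  by have r2 := sqr_ge0 r; rewrite mulr_gt0 //; lra.
have c : beta * (r ^+ 2 + s ^+ 2) = 1.
  by case: P0 => P0; rewrite P0 in c0; rewrite ?intrN in c0; lra.
exists (- P`_2), (P`_1); split => //=.
- by rewrite intrN c2; ring.
- by rewrite c1 /sqnorm /=; ring.
move=> w w0.
pose q : {poly int} := \poly_(i < 3) w (inord i).
have sz_q (F : numDomainType) : (size (map_poly (intr : int -> F) q) <= 3)%N.
  by rewrite size_map_inj_poly ?size_poly//; exact: intr_inj.
have q0 : map_poly (intr : int -> rat) q = 0.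
  apply/eqP; apply: contraT => q0.
  have : map_poly (intr : int -> rat) P %| map_poly intr q.
    apply: minimal_polynomial_dvd hp _; rewrite map_ratr_intr; apply/rootP.
    rewrite (horner_coef_wide _ (sz_q R)) -[RHS]w0; apply: eq_bigr => i _.
    by rewrite coef_map coef_poly ltn_ord inord_val.
  by move=> /dvdp_leq => /(_ q0); rewrite sz_P leqNgt ltnS sz_q.
move=> i; apply: (@intr_inj rat); rewrite -[in LHS](inord_val i).
have := congr1 (fun p : {poly rat} => p`_i) q0.
by rewrite coef_map coef_poly ltn_ord coef0.
Qed.

(** * The ring Z[b] and congruences in it *)

(** Products in [Z[b]] are computed on integer polynomials, whose values at the
    real and at the complex root are both multiplicative. *)
Definition zeval {T : comNzRingType} (P : {poly int}) (t : T) : T :=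
  (map_poly intr P).[t].

Lemma zevalD {T : comNzRingType} P Q (t : T) :
  zeval (P + Q) t = zeval P t + zeval Q t.
Proof. by rewrite /zeval rmorphD hornerD. Qed.

Lemma zevalN {T : comNzRingType} P (t : T) : zeval (- P) t = - zeval P t.
Proof. by rewrite /zeval rmorphN hornerN. Qed.

Lemma zevalM {T : comNzRingType} P Q (t : T) :
  zeval (P * Q) t = zeval P t * zeval Q t.
Proof. by rewrite /zeval rmorphM hornerM. Qed.

Lemma zevalC {T : comNzRingType} c (t : T) : zeval c%:P t = c%:~R.
Proof. by rewrite /zeval map_polyC hornerC. Qed.

Lemma zevalX {T : comNzRingType} (t : T) : zeval 'X t = t.
Proof. by rewrite /zeval map_polyX hornerX. Qed.

Lemma zevalXn {T : comNzRingType} P n (t : T) :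
  zeval (P ^+ n) t = zeval P t ^+ n.
Proof. by rewrite /zeval rmorphXn horner_exp. Qed.

Lemma quadE {T : comNzRingType} w (t : T) :
  quad w t = (w ord0)%:~R + (w (@Ordinal 3 1 isT))%:~R * t
             + (w (@Ordinal 3 2 isT))%:~R * t ^+ 2.
Proof.
rewrite /quad !big_ord_recl big_ord0 /= expr0 mulr1 expr1 addr0 addrA.
by congr (_ + (w _)%:~R * _ + (w _)%:~R * _); apply: val_inj.
Qed.

Lemma quad_zeval {T : comNzRingType} w (t : T) :
  quad w t = zeval (\poly_(i < 3) w (inord i)) t.
Proof.
rewrite /zeval (@horner_coef_wide _ 3).
  apply: eq_bigr => i _.
  by rewrite coef_map coef_poly ltn_ord inord_val.
by rewrite (leq_trans (size_poly _ _))// size_poly.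
Qed.

(** Reduction modulo the cubic yields coordinates that do not depend on the
    root, so the same triple serves for [b] and for [a]. *)
Lemma zeval_reduce (s1 s2 : int) P :
  exists w, forall (T : comNzRingType) (t : T),
  t ^+ 3 = s1%:~R * t ^+ 2 - s2%:~R * t + 1 -> zeval P t = quad w t.
Proof.
elim/poly_ind: P => [|P c [w IH]].
  by exists (fun=> 0) => T t _; rewrite quadE /zeval rmorph0 horner0; ring.
pose x := w ord0; pose y := w (@Ordinal 3 1 isT).
pose z := w (@Ordinal 3 2 isT).
exists (fun i => nth 0 [:: c + z; x - s2 * z; y + s1 * z] i) => T t t3.
rewrite zevalD zevalM zevalX zevalC (IH _ _ t3) !quadE /= -/x -/y -/z.
rewrite !(rmorphD, rmorphB, rmorphM) /=.
transitivity (x%:~R * t + y%:~R * t ^+ 2 + z%:~R * t ^+ 3 + c%:~R); first ring.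
by rewrite t3; ring.
Qed.

Lemma pigeonhole_nat (T : finType) (f : nat -> T) :
  exists i j, [/\ (i < j)%N, (j <= #|T|)%N & f i = f j].
Proof.
have /injectivePn[i [j ij fij]] : ~~ injectiveb (fun i : 'I_(#|T|.+1) => f i).
  by apply/injectiveP => /leq_card; rewrite card_ord ltnn.
wlog ltij : i j ij fij / (i < j)%N => [hw|].
  have [lij|lji|/val_inj eij] := ltngtP i j; first exact: (hw i j).
    by apply: (hw j i) => //; rewrite eq_sym.
  by rewrite eij eqxx in ij.
by exists i, j; split => //; rewrite -ltnS.
Qed.

Lemma sqnormM (R : realType) (x y : R[i]) :
  sqnorm (x * y) = sqnorm x * sqnorm y.
Proof. by case: x y => [x1 x2] [y1 y2]; rewrite /sqnorm /=; ring. Qed.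

Lemma ccu_cubic {R : realType} {b : R} {a : R[i]} {s1 s2} :
  complex_cubic_unit b a s1 s2 ->
  b ^+ 3 = s1%:~R * b ^+ 2 - s2%:~R * b + 1.
Proof. by case=> _ _ -> -> <- _; ring. Qed.

Lemma ccu_conj_cubic {R : realType} {b : R} {a : R[i]} {s1 s2} :
  complex_cubic_unit b a s1 s2 ->
  a ^+ 3 = s1%:~R * a ^+ 2 - s2%:~R * a + 1.
Proof.
case=> _ _ e1 e2 e3 _.
have intrC n : n%:~R = (n%:~R : R)%:C by rewrite rmorph_int.
have c1 : (1 : R[i]) = (b * sqnorm a)%:C by rewrite e3.
rewrite !intrC [in RHS]c1 e1 e2 /sqnorm; case: (a) => r s /=.
by apply/eqP; rewrite eq_complex /=; apply/andP; split; apply/eqP; ring.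
Qed.

Lemma ccu_pos {R : realType} {b : R} {a : R[i]} {s1 s2} :
  complex_cubic_unit b a s1 s2 -> 0 < b.
Proof. by case=> b1 _ _ _ _ _; rewrite (lt_trans ltr01). Qed.

(** Negative powers stay in the ring because the cubic relation reads
    [t (t^2 - s1 t + s2) = 1]. *)
Lemma ccu_exprz {R : realType} {b : R} {a : R[i]} {s1 s2} (m : int) :
  complex_cubic_unit b a s1 s2 ->
  exists P, zeval P b = b ^ m /\ zeval P a = a ^ m.
Proof.
move=> h; have b0 : b != 0 by rewrite gt_eqF// (ccu_pos h).
have a0 : a != 0.
  apply: contraTneq (oner_neq0 R) => a0; rewrite -(ccu_prod h) a0 /sqnorm /=.
  by rewrite expr0n /= addr0 mulr0 eqxx.
have inv (T : fieldType) (t : T) : t != 0 ->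
    t ^+ 3 = s1%:~R * t ^+ 2 - s2%:~R * t + 1 ->
    zeval ('X ^+ 2 - s1%:P * 'X + s2%:P) t = t^-1.
  move=> t0 t3; rewrite !(zevalD, zevalN, zevalM, zevalC, zevalXn, zevalX).
  apply: (mulfI t0); rewrite divff//.
  transitivity (t ^+ 3 - s1%:~R * t ^+ 2 + s2%:~R * t); first by ring.
  by rewrite t3; ring.
case: m => n.
  by exists ('X ^+ n); rewrite !zevalXn !zevalX -!exprnP.
exists (('X ^+ 2 - s1%:P * 'X + s2%:P) ^+ n.+1).
rewrite !zevalXn !inv ?(ccu_cubic h) ?(ccu_conj_cubic h)//.
by rewrite !NegzE !exprVn.
Qed.

Definition in_order {R : realType} (b u : R) := exists P, u = zeval P b.

Lemma in_orderD {R : realType} {b u v : R} :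
  in_order b u -> in_order b v -> in_order b (u + v).
Proof. by move=> [P ->] [Q ->]; exists (P + Q); rewrite zevalD. Qed.

Lemma in_orderN {R : realType} {b u : R} : in_order b u -> in_order b (- u).
Proof. by move=> [P ->]; exists (- P); rewrite zevalN. Qed.

Lemma in_orderM {R : realType} {b u v : R} :
  in_order b u -> in_order b v -> in_order b (u * v).
Proof. by move=> [P ->] [Q ->]; exists (P * Q); rewrite zevalM. Qed.

Lemma in_orderX {R : realType} {b u : R} n :
  in_order b u -> in_order b (u ^+ n).
Proof. by move=> [P ->]; exists (P ^+ n); rewrite zevalXn. Qed.

Lemma in_order_int {R : realType} (b : R) (c : int) : in_order b c%:~R.
Proof. by exists c%:P; rewrite zevalC. Qed.

Lemma in_order_nat {R : realType} (b : R) (n : nat) : in_order b n%:R.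
Proof. exact: (in_order_int b n). Qed.

Lemma in_order_quad {R : realType} (b : R) w : in_order b (quad w b).
Proof. by eexists; exact: quad_zeval. Qed.

Lemma in_order_exprz {R : realType} {b : R} {a : R[i]} {s1 s2} (m : int) :
  complex_cubic_unit b a s1 s2 -> in_order b (b ^ m).
Proof. by move=> /(ccu_exprz m)[P [<- _]]; exists P. Qed.

Lemma in_order_reduce {R : realType} {b : R} {a : R[i]} {s1 s2} u :
  complex_cubic_unit b a s1 s2 -> in_order b u -> exists w, u = quad w b.
Proof.
move=> h [P ->]; have [w hw] := zeval_reduce s1 s2 P; exists w.
exact: hw (ccu_cubic h).
Qed.

(** Congruence modulo the ideal [M Z[b]]. *)
Definition congz {R : realType} (b : R) (M : nat) (u v : R) :=
  in_order b ((u - v) / M%:R).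

Lemma congz_sym {R : realType} {b : R} {M u v} :
  congz b M u v -> congz b M v u.
Proof. by move=> /in_orderN; rewrite -mulNr opprB. Qed.

Lemma congz_trans {R : realType} {b : R} {M u v w} :
  congz b M u v -> congz b M v w -> congz b M u w.
Proof.
by move=> h1 h2; have := in_orderD h1 h2; rewrite -mulrDl addrA subrK.
Qed.

Lemma congzMl {R : realType} {b : R} {M u v} c :
  in_order b c -> congz b M u v -> congz b M (c * u) (c * v).
Proof. by move=> hc /(in_orderM hc); rewrite mulrA mulrBr. Qed.

Lemma congzX {R : realType} {b : R} {M u v} n :
  in_order b u -> in_order b v -> congz b M u v ->
  congz b M (u ^+ n) (v ^+ n).
Proof.
move=> hu hv huv; elim: n => [|n IH].
  by rewrite !expr0 /congz subrr mul0r; exact: (in_order_nat b 0).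
rewrite !exprS; apply: congz_trans (congzMl _ hu IH) _.
by rewrite ![_ * v ^+ n]mulrC; apply: congzMl => //; apply: in_orderX.
Qed.

Lemma congz_dvd {R : realType} {b : R} {M N u v} :
  (0 < N)%N -> (M %| N)%N -> congz b N u v -> congz b M u v.
Proof.
move=> N0 /dvdnP[k Nk]; subst N.
move: N0; rewrite muln_gt0 => /andP[k0 M0].
move=> /(in_orderM (in_order_nat b k)); rewrite /congz natrM.
suff -> : k%:R * ((u - v) / (k%:R * M%:R)) = (u - v) / M%:R by [].
by field; rewrite !pnatr_eq0 -!lt0n k0 M0.
Qed.

(** [Z[b] / M Z[b]] is finite: a class is determined by the residues of the
    three coordinates. *)
Lemma congz_pigeonhole {R : realType} {b : R} {a : R[i]} {s1 s2} M
    (f : nat -> R) :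
  complex_cubic_unit b a s1 s2 -> (0 < M)%N -> (forall i, in_order b (f i)) ->
  exists i j, (i < j)%N /\ congz b M (f i) (f j).
Proof.
case: M => // M h _ hf.
have /choice[w hw] i := in_order_reduce (f i) h (hf i).
pose r i : {ffun 'I_3 -> 'I_M.+1} := [ffun k => inord `|(w i k %% M.+1)%Z|%N].
have [i [j [ltij _ rij]]] := pigeonhole_nat _ r.
exists i, j; split => //; rewrite /congz !hw.
have residue_lt (x : int) : 0 <= (x %% M.+1)%Z < M.+1%:Z.
  by rewrite modz_ge0 // ltz_pmod.
have wij k :
    w i k = ((w i k %/ M.+1)%Z - (w j k %/ M.+1)%Z) * M.+1%:Z + w j k.
  have /(congr1 val) : r i k = r j k by rewrite rij.
  rewrite !ffunE /= !inordK => [||]; last 2 first.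
  - by have := residue_lt (w i k); lia.
  - by have := residue_lt (w j k); lia.
  have := residue_lt (w i k); have := residue_lt (w j k).
  by have := divz_eq (w i k) M.+1; have := divz_eq (w j k) M.+1; lia.
have -> : (quad (w i) b - quad (w j) b) / M.+1%:R =
    quad (fun k => (w i k %/ M.+1)%Z - (w j k %/ M.+1)%Z) b.
  apply: (canLR (mulfK _)); first by rewrite pnatr_eq0.
  rewrite /quad -sumrB mulr_suml; apply: eq_bigr => k _.
  by rewrite [in LHS]wij rmorphD rmorphM /=; ring.
exact: in_order_quad.
Qed.

(** * Moduli for which the order of a unit is divisible by a given integer *)

(** The powers of [p] have no common nonzero multiple in [Z[b]]: a nonzero
    coordinate of [u] would be divisible by an integer larger than itself. *)
Lemma order_separated {R : realType} {b : R} {a : R[i]} {s1 s2} (p : nat) u :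
  complex_cubic_unit b a s1 s2 -> (1 < p)%N -> in_order b u -> u != 0 ->
  exists s, ~ in_order b (u / (p ^ s)%:R).
Proof.
move=> h p1 hu u0; have [w uE] := in_order_reduce u h hu.
have [i wi0] : exists i, w i != 0.
  apply: contra_notP (negP u0) => /forallNP w0.
  rewrite uE /quad big1// => i _.
  by have /negP/negPn/eqP -> := w0 i; rewrite mul0r.
(* [p ^ |w i|] exceeds [|w i|], hence cannot divide [w i]. *)
exists `|w i|%N => /(in_order_reduce _ h)[v vE].
have p0 : (p ^ `|w i|)%:R != 0 :> R by rewrite pnatr_eq0 expn_eq0; lia.
have w0 : quad (fun k => w k - v k * (p ^ `|w i|)%N%:Z) b = 0.
  rewrite -[RHS](subrr u) {1}uE -[in RHS](divfK p0 u) vE /quad mulr_suml.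
  rewrite -sumrB; apply: eq_bigr => k _.
  by rewrite rmorphB rmorphM /=; ring.
have /eqP := ccu_free h _ w0 i; rewrite subr_eq0 => /eqP wE.
have := ltn_expl `|w i| p1; rewrite {1}wE abszM absz_nat ltnNge.
rewrite leq_pmull// absz_gt0.
by apply: contraNneq wi0 => v0; rewrite wE v0 mul0r.
Qed.

(** Raising [v = 1] modulo [p^s] to the power [p] gains a factor [p], since
    [v^p - 1] is [v - 1] times a sum of [p] terms congruent to 1 modulo [p]. *)
Lemma congz_lift {R : realType} {b : R} {p} {u : R} s :
  (0 < p)%N -> in_order b u -> congz b p u 1 ->
  congz b (p ^ s.+1) (u ^+ (p ^ s)) 1.
Proof.
move=> p0 hu hup; elim: s => [|s IH]; first by rewrite expn1 expn0 expr1.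
have one : in_order b 1 by exact: (in_order_nat b 1).
have hv : in_order b (u ^+ (p ^ s)) by exact: in_orderX.
have vp : congz b p (u ^+ (p ^ s)) 1.
  by have := congzX (p ^ s) hu one hup; rewrite expr1n.
rewrite [in u ^+ _]expnSr exprM; move: (u ^+ _) IH hv vp => v IH hv vp.
have sum_v n : congz b p (\sum_(i < n) v ^+ i) n%:R.
  elim: n => [|n IHn].
    by rewrite big_ord0 /congz subrr mul0r; exact: (in_order_nat b 0).
  have := congzX n hv one vp; rewrite expr1n big_ord_recr /= /congz => vn.
  by rewrite -natr1 opprD addrACA mulrDl; exact: in_orderD.
have sum_p : in_order b ((\sum_(i < p) v ^+ i) / p%:R).
  have := in_orderD (sum_v p) one.
  by rewrite mulrBl divff ?subrK// pnatr_eq0 -lt0n.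
have := in_orderM IH sum_p.
by rewrite /congz mulrACA -invfM -natrM -expnSr subrX1.
Qed.

Lemma congz_gcd {R : realType} {b u : R} M m n :
  in_order b u -> congz b M (u ^+ m) 1 -> congz b M (u ^+ n) 1 ->
  congz b M (u ^+ gcdn m n) 1.
Proof.
move=> hu hm hn; have [->|m0] := posnP m; first by rewrite gcd0n.
have one : in_order b 1 by exact: (in_order_nat b 1).
have [km kn e _] := egcdnP n m0.
have hm' := congzX km (in_orderX m hu) one hm.
have hn' := congzX kn (in_orderX n hu) one hn.
rewrite -!exprM !expr1n mulnC e mulnC in hm' hn'.
have := congzMl (u ^+ gcdn m n) (in_orderX _ hu) hn'.
rewrite -exprD mulr1 addnC [(n * kn)%N]mulnC => /congz_sym h.
by apply: congz_trans h _; rewrite mulnC.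
Qed.

(** Let [u^t0 = 1] modulo [p] and let [p^s] not divide [u^t0 - 1].  Modulo
    [p^(s+1)] the exponent [t0 p^s] kills [u]; so if some [t] prime to [p] did
    as well, then so would their gcd, which divides [t0]. *)
Lemma exists_prime_modulus {R : realType} {b : R} {a : R[i]} {s1 s2}
    (p : nat) u :
  complex_cubic_unit b a s1 s2 -> prime p ->
  in_order b u -> in_order b u^-1 -> u != 0 ->
  (forall t, (0 < t)%N -> u ^+ t != 1) ->
  exists2 M, (0 < M)%N & forall t, congz b M (u ^+ t) 1 -> (p %| t)%N.
Proof.
move=> h p_pr hu hui u0 u_free.
have p0 := prime_gt0 p_pr; have p1 := prime_gt1 p_pr.
have one : in_order b 1 by exact: (in_order_nat b 1).
have [t0 t0_gt0 ut0] : exists2 t0, (0 < t0)%N & congz b p (u ^+ t0) 1.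
  have [i [j [ltij]]] := congz_pigeonhole p _ h p0 (fun i => in_orderX i hu).
  move=> /(congzMl (u^-1 ^+ i) (in_orderX i hui)) /congz_sym.
  rewrite -exprMn mulVf// expr1n -[in u ^+ j](subnKC (ltnW ltij)) exprD mulrA.
  rewrite -exprMn mulVf// expr1n mul1r => hc.
  by exists (j - i)%N; rewrite ?subn_gt0.
have ut0_neq : u ^+ t0 - 1 != 0 by rewrite subr_eq0 u_free.
have hut0 : in_order b (u ^+ t0 - 1).
  exact: in_orderD (in_orderX _ hu) (in_orderN one).
have [s hs] := order_separated p _ h p1 hut0 ut0_neq.
exists (p ^ s.+1)%N; first by rewrite expn_gt0 p0.
move=> t ht; apply/negPn/negP => npt; apply: hs.
have := congz_lift s p0 (in_orderX t0 hu) ut0; rewrite -exprM => h2.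
have := congz_gcd _ _ _ hu ht h2.
rewrite Gauss_gcdl; last by rewrite coprime_sym coprimeXl// prime_coprime.
have /dvdnP[k t0E] := dvdn_gcdr t t0.
move=> /(congzX k (in_orderX _ hu) one); rewrite expr1n -exprM mulnC -t0E.
by apply: congz_dvd; rewrite ?expn_gt0 ?p0// dvdn_exp2l.
Qed.

(** The prime factors of [H] are removed one at a time, replacing [u] by [u^p];
    this is why [u] is not required to be [b] itself. *)
Lemma exists_modulus {R : realType} {b : R} {a : R[i]} {s1 s2} (H : nat) u :
  complex_cubic_unit b a s1 s2 -> (0 < H)%N ->
  in_order b u -> in_order b u^-1 -> u != 0 ->
  (forall t, (0 < t)%N -> u ^+ t != 1) ->
  exists2 M, (0 < M)%N & forall t, congz b M (u ^+ t) 1 -> (H %| t)%N.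
Proof.
move=> h; elim/ltn_ind: H u => H IH u H0 hu hui u0 u_free.
have [H1|H1] := leqP H 1.
  by exists 1%N => // t _; rewrite (_ : H = 1%N) ?dvd1n//; lia.
have p_pr := pdiv_prime H1; have p0 := prime_gt0 p_pr.
have /dvdnP[H' HE] := pdiv_dvd H; set p := pdiv H in p_pr p0 HE.
have H'0 : (0 < H')%N by move: H0; rewrite HE muln_gt0 => /andP[].
have H'H : (H' < H)%N by rewrite HE ltn_Pmulr// prime_gt1.
have [M1 M1_gt0 hM1] := exists_prime_modulus p u h p_pr hu hui u0 u_free.
have [|||t t0|M2 M2_gt0 hM2] := IH H' H'H (u ^+ p) H'0.
- exact: in_orderX.
- by rewrite -exprVn; exact: in_orderX.
- by rewrite expf_neq0.
- by rewrite -exprM u_free// muln_gt0 p0.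
exists (M1 * M2)%N; first by rewrite muln_gt0 M1_gt0.
move=> t ht.
have M0 : (0 < M1 * M2)%N by rewrite muln_gt0 M1_gt0.
have /hM1/dvdnP[t' tE] := congz_dvd M0 (dvdn_mulr M2 (dvdnn M1)) ht.
have := congz_dvd M0 (dvdn_mull M1 (dvdnn M2)) ht.
by rewrite tE mulnC exprM => /hM2 ?; rewrite HE mulnC dvdn_pmul2l.
Qed.

(** * Elements of norm one are powers of b up to finite index *)

(** For [a = r + i s], the real and imaginary parts [p] and [q] of the value at
    [a] and the value [L] at [b] are three linear forms in the coordinates.
    They are independent as [s] is nonzero, so the coordinates are linear forms
    in [L], [p], [q]; the constants [d] are the coefficients of [L]. *)
Lemma coord_approx {R : realType} {b : R} {a : R[i]} {s1 s2} :
  complex_cubic_unit b a s1 s2 ->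
  exists (d : 'I_3 -> R) (C : R), forall w, sqnorm (quad w a) <= 1 ->
    forall i, `|(w i)%:~R - d i * quad w b| <= C.
Proof.
case: a => r s; case=> /= b1 s0 _ _ _ _.
pose D := (b - r) ^+ 2 + s ^+ 2.
have D0 : 0 < D by rewrite /D ltr_wpDl ?sqr_ge0// exprn_even_gt0.
pose C2 := (1 + `|s|^-1 * `|b - r|) / D.
pose C1 := `|s|^-1 + 2 * `|r| * C2.
pose C0 := 1 + `|r| * C1 + `|r ^+ 2 - s ^+ 2| * C2.
have C2_ge0 : 0 <= C2.
  apply: divr_ge0; last exact: ltW.
  by rewrite addr_ge0 ?mulr_ge0 ?invr_ge0.
have C1_ge0 : 0 <= C1.
  by rewrite /C1 addr_ge0 ?invr_ge0// mulr_ge0// mulr_ge0.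
have C0_ge0 : 0 <= C0.
  by rewrite /C0 addr_ge0 ?addr_ge0// mulr_ge0.
exists (fun i => nth 0 [:: (r ^+ 2 + s ^+ 2) / D; - (2 * r) / D; D^-1] i).
exists (C0 + C1 + C2) => w.
pose x : R := (w ord0)%:~R; pose y : R := (w (@Ordinal 3 1 isT))%:~R.
pose z : R := (w (@Ordinal 3 2 isT))%:~R.
pose p := x + y * r + z * (r ^+ 2 - s ^+ 2); pose q := s * (y + 2 * r * z).
have -> : quad w (r +i* s) = p +i* q.
  have intrC n : n%:~R = (n%:~R : R)%:C by rewrite rmorph_int.
  rewrite quadE !intrC /p /q /x /y /z.
  by apply/eqP; rewrite eq_complex /=; apply/andP; split; apply/eqP; ring.
rewrite /sqnorm /= => pq1.
have norm_le1 (t : R) : t ^+ 2 <= 1 -> `|t| <= 1.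
  by rewrite -(@expr_le1 _ 2 `|t|)// -normrX ger0_norm ?sqr_ge0.
have p1 : `|p| <= 1.
  by rewrite norm_le1 // (le_trans _ pq1) // lerDl sqr_ge0.
have q1 : `|q| <= 1.
  by rewrite norm_le1 // (le_trans _ pq1) // lerDr sqr_ge0.
set L := quad w b.
have LE : L = p + q / s * (b - r) + z * D.
  by rewrite /L quadE -/x -/y -/z /p /q /D; field.
have k1 : `|q / s| <= `|s|^-1 by rewrite normrM normfV ler_piMl ?invr_ge0.
have z2 : `|z - D^-1 * L| <= C2.
  have -> : z - D^-1 * L = - ((p + q / s * (b - r)) / D).
    by rewrite LE; field; rewrite s0 gt_eqF.
  rewrite normrN normrM normfV (gtr0_norm D0) ler_pM2r ?invr_gt0//.
  by rewrite (le_trans (ler_normD _ _))// lerD// normrM ler_wpM2r.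
have y1 : `|y - - (2 * r) / D * L| <= C1.
  have -> : y - - (2 * r) / D * L = q / s - 2 * r * (z - D^-1 * L).
    by rewrite /q; field; rewrite s0 gt_eqF.
  rewrite (le_trans (ler_normB _ _))// lerD// !normrM ger0_norm//.
  by rewrite ler_wpM2l ?mulr_ge0.
have x0 : `|x - (r ^+ 2 + s ^+ 2) / D * L| <= C0.
  have -> : x - (r ^+ 2 + s ^+ 2) / D * L =
     p - r * (y - - (2 * r) / D * L) - (r ^+ 2 - s ^+ 2) * (z - D^-1 * L).
    by rewrite /p; field; rewrite gt_eqF.
  rewrite (le_trans (ler_normB _ _))// lerD//; last by rewrite normrM ler_wpM2l.
  by rewrite (le_trans (ler_normB _ _))// lerD// normrM ler_wpM2l.
case; case=> [|[|[|//]]] hi /=.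
- have -> : Ordinal hi = ord0 by exact: val_inj.
  by apply: le_trans x0 _; rewrite -addrA lerDl addr_ge0.
- rewrite (bool_irrelevance hi isT); apply: le_trans y1 _.
  by rewrite addrAC lerDr addr_ge0.
- rewrite (bool_irrelevance hi isT); apply: le_trans z2 _.
  by rewrite lerDr addr_ge0.
Qed.

Lemma exprz_normalize {R : realType} (b x : R) :
  1 < b -> 0 < x -> exists m : int, 1 <= x * b ^ m < b.
Proof.
move=> b1 x0; have b0 : 0 < b by rewrite (lt_trans ltr01).
have lb : 0 < ln b by rewrite ln_gt0.
pose m := Num.floor (ln x / ln b).
have xE : x = expR (ln x / ln b * ln b) by rewrite divfK ?gt_eqF// lnK.
have bE (k : int) : b ^ k = expR (k%:~R * ln b).
  have e n : b ^+ n = expR (n%:R * ln b) by rewrite expRM_natl lnK.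
  case: k => n; first by rewrite -exprnP e.
  by rewrite NegzE -exprnN e intrN mulNr expRN.
exists (- m); rewrite xE bE -expRD intrN mulNr -mulrBl.
rewrite -[X in _ < X]lnK// -[X in X <= _]expR0 ler_expR ltr_expR.
have /andP[f1 f2] := floor_itv (ln x / ln b); rewrite intrD in f2.
rewrite pmulr_lge0// subr_ge0 f1 /=.
by rewrite gtr_pMl// ltrBlDr addrC.
Qed.

Lemma sqnormX {R : realType} (z : R[i]) n : sqnorm (z ^+ n) = sqnorm z ^+ n.
Proof.
elim: n => [|n IH]; last by rewrite !exprS sqnormM IH.
by rewrite !expr0 /sqnorm /= expr1n expr0n /= addr0.
Qed.

Lemma ccu_norm_exprz {R : realType} {b : R} {a : R[i]} {s1 s2} (m : int) :
  complex_cubic_unit b a s1 s2 -> b ^ m * sqnorm (a ^ m) = 1.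
Proof.
move=> h.
have pos n : b ^+ n * sqnorm (a ^+ n) = 1.
  by rewrite sqnormX -exprMn (ccu_prod h) expr1n.
case: m => n; first exact: pos.
rewrite NegzE -!exprnN.
have bn0 : b ^+ n.+1 != 0 by rewrite expf_neq0// gt_eqF// (ccu_pos h).
have an0 : a ^+ n.+1 != 0.
  apply: contraTneq (oner_neq0 R) => an0; rewrite -(pos n.+1) an0 /sqnorm /=.
  by rewrite expr0n /= addr0 mulr0 eqxx.
have inv : sqnorm (a ^+ n.+1) * sqnorm (a ^+ n.+1)^-1 = 1.
  by rewrite -sqnormM divff// -(expr0 a) sqnormX.
rewrite -[LHS]mul1r -[X in X * _](pos n.+1) mulrACA divff// mul1r.
exact: inv.
Qed.

(** For every [k] some multiple [u^k b^m] lies in the interval from 1 to [b].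
    It has norm one, so its conjugate lies in the unit disc and its coordinates
    lie in a fixed finite box.  Two exponents [k] at most the size of the box
    give the same element, whence a power of [u] is a power of [b].  The
    factorial of the size of the box makes the exponent uniform in [u]. *)
Lemma unit_power {R : realType} {b : R} {a : R[i]} {s1 s2} :
  complex_cubic_unit b a s1 s2 ->
  exists2 H, (0 < H)%N & forall P, 0 < zeval P b ->
    zeval P b * sqnorm (zeval P a) = 1 ->
    exists l : int, zeval P b ^+ H = b ^ l.
Proof.
move=> h; have [d [C hC]] := coord_approx h; have b1 := ccu_gt1 h.
have b0 : 0 < b := ccu_pos h.
pose B := (Num.truncn (C + \sum_i `|d i| * b)).+1.
have box w : sqnorm (quad w a) <= 1 -> 0 <= quad w b <= b ->
    forall i, (`|w i| < B)%N.
  move=> wa /andP[w0 wb] i.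
  rewrite -(ltr_nat R) natr_absz intr_norm.
  apply: le_lt_trans (truncnS_gt _).
  rewrite -[X in `|X|](subrK (d i * quad w b)) (le_trans (ler_normD _ _))//.
  rewrite lerD ?hC// normrM (ger0_norm w0).
  rewrite (bigD1 i)//= ler_wpDr ?sumr_ge0// => [j _|].
    by rewrite mulr_ge0// ltW.
  by rewrite ler_wpM2l.
exists (#|{: {ffun 'I_3 -> 'I_(B.*2).+1}}|)`!%N; first exact: fact_gt0.
move=> P; set u := zeval P b => u0 un.
have ex k : exists wm : ('I_3 -> int) * int,
    [/\ quad wm.1 b = u ^+ k * b ^ wm.2 & forall i, (`|wm.1 i|%N < B)%N].
  have [m /andP[m1 mb]] := exprz_normalize b _ b1 (exprn_gt0 k u0).
  have [Q [Qb Qa]] := ccu_exprz m h.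
  have [w wE] := zeval_reduce s1 s2 (P ^+ k * Q).
  have wb := wE _ _ (ccu_cubic h); have wa := wE _ _ (ccu_conj_cubic h).
  rewrite !zevalM !zevalXn Qb Qa in wb wa.
  exists (w, m); split=> //=; apply: box; rewrite -?wb -?wa; last first.
    by rewrite (le_trans ler01)//= ltW.
  have : (u ^+ k * b ^ m) * sqnorm (zeval P a ^+ k * a ^ m) = 1.
    rewrite sqnormM mulrACA (ccu_norm_exprz m h) mulr1.
    by rewrite sqnormX -exprMn un expr1n.
  move=> e1.
  have s0 : 0 <= sqnorm (zeval P a ^+ k * a ^ m) by rewrite addr_ge0 ?sqr_ge0.
  by rewrite -e1 ler_peMl.
have /choice[wm hwm] := ex.
pose F k : {ffun 'I_3 -> 'I_(B.*2).+1} :=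
  [ffun i => inord (absz ((wm k).1 i + B%:Z))].
have [i [j [ltij leij Fij]]] := pigeonhole_nat _ F.
have wij : (wm i).1 =1 (wm j).1.
  move=> k; have /(congr1 val) : F i k = F j k by rewrite Fij.
  have [_ /(_ k) bi] := hwm i; have [_ /(_ k) bj] := hwm j.
  by rewrite !ffunE /= !inordK; lia.
have eqij : u ^+ i * b ^ (wm i).2 = u ^+ j * b ^ (wm j).2.
  have [<- _] := hwm i; have [<- _] := hwm j.
  by apply: eq_bigr => k _; rewrite wij.
have uji : u ^+ (j - i) = b ^ ((wm i).2 - (wm j).2).
  rewrite expfzDr ?gt_eqF// -invr_expz.
  apply: (canRL (mulfK _)); first by rewrite expfz_neq0// gt_eqF.
  have ui : u ^+ i != 0 by rewrite expf_neq0// gt_eqF.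
  by apply: (mulfI ui); rewrite mulrA -exprD subnKC// ltnW.
have /dvdnP[q ->] : (j - i %| (#|{: {ffun 'I_3 -> 'I_(B.*2).+1}}|)`!)%N.
  by rewrite dvdn_fact// subn_gt0 ltij /= (leq_trans (leq_subr _ _)).
exists (((wm i).2 - (wm j).2) * q%:Z).
by rewrite mulnC exprM uji exprnP exprz_exp.
Qed.

(** Being congruent to a power of [b] forces the exponent [l] in [u^H = b^l] to
    be a multiple of [H]; positive reals have unique [H]-th roots. *)
Lemma power_congruence {R : realType} {b : R} {a : R[i]} {s1 s2} :
  complex_cubic_unit b a s1 s2 ->
  exists2 M, (0 < M)%N & forall P, 0 < zeval P b ->
    zeval P b * sqnorm (zeval P a) = 1 ->
    forall j : nat, congz b M (zeval P b) (b ^+ j) ->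
    exists k : int, zeval P b = b ^ k.
Proof.
move=> h; have b0 := ccu_pos h; have bn0 : b != 0 by rewrite gt_eqF.
have [H H0 hH] := unit_power h.
have b_in m : in_order b (b ^ m) := in_order_exprz m h.
have [|||t t0|M M0 hM] := exists_modulus H b h H0.
- exact: (b_in 1).
- exact: (b_in (-1)).
- exact: bn0.
- by rewrite gt_eqF// exprn_egt1 ?(ccu_gt1 h)// -lt0n.
exists M => // P; set u := zeval P b => u0 un j uj.
have u_in : in_order b u by exists P.
have [l ul] := hH P u0 un; rewrite -/u in ul.
have hMz m : congz b M (b ^ m) 1 -> (H %| m)%Z.
  case: m => n; first by move=> /hM.
  move=> /(congzMl _ (b_in n.+1)) /congz_sym; rewrite NegzE -expfzDr// subrr.
  by rewrite mulr1 expr0z => /hM; rewrite dvdzE.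
have := congzX H u_in (in_orderX j (b_in 1)) uj.
rewrite ul -exprM => /(congzMl _ (b_in (- (j * H)%N%:Z))).
rewrite exprnP -!expfzDr// addNr expr0z => /hMz /dvdzP[q lE].
exists (q + j%:Z); apply/eqP.
rewrite -(@eqrXn2 _ H)//; [|exact: ltW|by rewrite exprz_ge0// ltW].
apply/eqP; rewrite ul [RHS]exprnP exprz_exp; congr (_ ^ _); lia.
Qed.

(** * Tests computed by generalised polynomials *)

Lemma gp_map_nat_ext {R : realType} {u v : nat -> R} :
  u =1 v -> gp_map_nat u -> gp_map_nat v.
Proof. by move=> uv [g hg ug]; exists g => // n; rewrite -uv. Qed.

Lemma gp_map_nat_cst {R : realType} (c : R) : gp_map_nat (fun=> c).
Proof.
exists (fun x => (c%:P).[x]); first exact: gp_map_poly.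
by move=> n; rewrite hornerC.
Qed.

Lemma gp_map_nat_id (R : realType) : gp_map_nat (fun n => n%:R : R).
Proof.
exists (fun x => ('X : {poly R}).[x]); first exact: gp_map_poly.
by move=> n; rewrite hornerX.
Qed.

Lemma gp_map_natD {R : realType} {u v : nat -> R} :
  gp_map_nat u -> gp_map_nat v -> gp_map_nat (fun n => u n + v n).
Proof.
move=> [f hf uf] [g hg vg]; exists (fun x => f x + g x).
  exact: gp_map_add.
by move=> n; rewrite uf vg.
Qed.

Lemma gp_map_natM {R : realType} {u v : nat -> R} :
  gp_map_nat u -> gp_map_nat v -> gp_map_nat (fun n => u n * v n).
Proof.
move=> [f hf uf] [g hg vg]; exists (fun x => f x * g x).
  exact: gp_map_mul.
by move=> n; rewrite uf vg.
Qed.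

Lemma gp_map_natZ {R : realType} {u : nat -> R} c :
  gp_map_nat u -> gp_map_nat (fun n => c * u n).
Proof. by apply: gp_map_natM; exact: gp_map_nat_cst. Qed.

(** Integrality is recorded in the type because the tests for vanishing and for
    divisibility below are correct for integer values only. *)
Definition gp_int (R : realType) (u : nat -> int) :=
  gp_map_nat (fun n => (u n)%:~R : R).

Lemma gp_int_cst (R : realType) (c : int) : gp_int R (fun=> c).
Proof. exact: gp_map_nat_cst. Qed.

Lemma gp_int_id (R : realType) : gp_int R (fun n => n%:Z).
Proof. exact: gp_map_nat_id. Qed.

Lemma gp_intD {R : realType} {u v} :
  gp_int R u -> gp_int R v -> gp_int R (fun n => u n + v n).
Proof.
move=> hu hv; apply: gp_map_nat_ext (gp_map_natD hu hv) => n.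
by rewrite intrD.
Qed.

Lemma gp_intM {R : realType} {u v} :
  gp_int R u -> gp_int R v -> gp_int R (fun n => u n * v n).
Proof.
move=> hu hv; apply: gp_map_nat_ext (gp_map_natM hu hv) => n.
by rewrite intrM.
Qed.

Lemma gp_intX {R : realType} {u} k : gp_int R u -> gp_int R (fun n => u n ^+ k).
Proof.
move=> hu; elim: k => [|k IH]; first exact: (gp_int_cst R 1).
by apply: gp_map_nat_ext (gp_intM hu IH) => n; rewrite exprS.
Qed.

Lemma gp_intN {R : realType} {u} : gp_int R u -> gp_int R (fun n => - u n).
Proof.
move=> hu; apply: gp_map_nat_ext (gp_intM (gp_int_cst R (-1)) hu) => n.
by rewrite mulN1r.
Qed.

Lemma gp_intB {R : realType} {u v} :
  gp_int R u -> gp_int R v -> gp_int R (fun n => u n - v n).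
Proof. by move=> hu hv; apply: gp_intD => //; apply: gp_intN. Qed.

Lemma gp_int_floor {R : realType} {u : nat -> R} :
  gp_map_nat u -> gp_int R (fun n => Num.floor (u n)).
Proof.
move=> [f hf uf]; exists (fun x => (Num.floor (f x))%:~R).
  exact: gp_map_floor.
by move=> n; rewrite uf.
Qed.

Definition gp_test (R : realType) (P : nat -> bool) :=
  gp_map_nat (fun n => (P n)%:R : R).

Lemma gp_test_cst (R : realType) (c : bool) : gp_test R (fun=> c).
Proof. exact: gp_map_nat_cst. Qed.

Lemma gp_test_and {R : realType} {P Q : nat -> bool} :
  gp_test R P -> gp_test R Q -> gp_test R (fun n => P n && Q n).
Proof.
move=> hP hQ; apply: gp_map_nat_ext (gp_map_natM hP hQ) => n.
by rewrite -natrM mulnb.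
Qed.

Lemma gp_test_not {R : realType} {P : nat -> bool} :
  gp_test R P -> gp_test R (fun n => ~~ P n).
Proof.
move=> hP.
apply: gp_map_nat_ext (gp_map_natD (gp_map_nat_cst 1) (gp_map_natZ (-1) hP)).
by move=> n; case: (P n) => /=; ring.
Qed.

Lemma gp_test_forall {R : realType} {T : finType} {P : T -> nat -> bool} :
  (forall t, gp_test R (P t)) -> gp_test R (fun n => [forall t, P t n]).
Proof.
move=> hP; suff h s : gp_test R (fun n => all (P^~ n) s).
  apply: gp_map_nat_ext (h (enum T)) => n; congr (_%:R); congr nat_of_bool.
  apply/allP/forallP => [h1 t|h1 t _]; last exact: h1.
  by apply: h1; rewrite mem_enum.
elim: s => [|t s IH]; first exact: (gp_test_cst R true).
exact: gp_test_and.
Qed.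

Lemma gp_test_exists {R : realType} {T : finType} {P : T -> nat -> bool} :
  (forall t, gp_test R (P t)) -> gp_test R (fun n => [exists t, P t n]).
Proof.
move=> hP.
have := gp_test_not (gp_test_forall (fun t => gp_test_not (hP t))).
apply: gp_map_nat_ext => n; congr (_%:R); congr nat_of_bool.
by rewrite negb_forall; apply: eq_existsb => t; rewrite negbK.
Qed.

(** With [x = theta * u n], the integer [floor (floor x - x)] is 0 when [x] is
    an integer and -1 otherwise, and [x] is an integer only if [u n = 0]. *)
Lemma gp_test_eq0 {R : realType} {u : nat -> int} (theta : R) :
  (forall k m : int, k%:~R * theta = m%:~R -> k = 0) ->
  gp_int R u -> gp_test R (fun n => u n == 0).
Proof.
move=> irr hu.
have hf := gp_int_floor (gp_map_natZ theta hu).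
have := gp_int_floor (gp_map_natD hf (gp_map_natZ (-1) (gp_map_natZ theta hu))).
move=> /(gp_intD (gp_int_cst R 1)); apply: gp_map_nat_ext => n /=.
set x := theta * (u n)%:~R; have /andP[x1 x2] := floor_itv x.
rewrite intrD in x2.
have [un0|un0] := eqVneq (u n) 0.
  have -> : x = 0 by rewrite /x un0 mulr0.
  by rewrite mulr0 addr0 floor0 intrKfloor addr0.
have xN : (Num.floor x)%:~R != x.
  apply: contraNneq un0 => e.
  by rewrite (irr (u n) (Num.floor x)) ?eqxx// e mulrC.
rewrite (_ : Num.floor (_ + _) = -1)//.
apply: floor_def; rewrite addNr.
have : (Num.floor x)%:~R < x by rewrite lt_neqAle xN.
by move=> ?; apply/andP; split; lra.
Qed.

(** [M] divides [x] exactly when [x - M * floor (x / M)] vanishes. *)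
Lemma gp_test_dvd {R : realType} {u : nat -> int} (theta : R) (M : nat) :
  (forall k m : int, k%:~R * theta = m%:~R -> k = 0) -> (0 < M)%N ->
  gp_int R u -> gp_test R (fun n => (M %| u n)%Z).
Proof.
move=> irr M0 hu.
have hq := gp_int_floor (gp_map_natZ M%:R^-1 hu).
have := gp_test_eq0 theta irr (gp_intB hu (gp_intM (gp_int_cst R M) hq)).
apply: gp_map_nat_ext => n; congr (_%:R); congr nat_of_bool.
rewrite subr_eq0; apply/eqP/dvdzP => [->|[q ->]].
  by eexists; rewrite mulrC.
have -> : M%:R^-1 * (q * M%:Z)%:~R = q%:~R :> R.
  by rewrite intrM mulrC mulfK// pnatr_eq0 -lt0n.
by rewrite intrKfloor mulrC.
Qed.

(** * Recognising the powers of b *)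

Lemma ccu_irrational {R : realType} {b : R} {a : R[i]} {s1 s2} :
  complex_cubic_unit b a s1 s2 ->
  forall k m : int, k%:~R * b = m%:~R -> k = 0.
Proof.
move=> h k m kbm.
have := ccu_free h (fun i => nth 0 [:: - m; k; 0] i).
rewrite quadE /= kbm intrN mul0r addr0 addNr => /(_ erefl).
by move=> /(_ (@Ordinal 3 1 isT)).
Qed.

(** The norm of [Z[b]] in coordinates, as a symmetric function of the roots
    expressed through [s1], [s2] and the product 1 of the roots. *)
Definition norm_form (s1 s2 : int) (w : 'I_3 -> int) : int :=
  let x := w ord0 in let y := w (@Ordinal 3 1 isT) in
  let z := w (@Ordinal 3 2 isT) in
  x ^+ 3 + x ^+ 2 * y * s1 + x ^+ 2 * z * (s1 ^+ 2 - 2 * s2)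
  + x * y ^+ 2 * s2 + x * y * z * (s1 * s2 - 3)
  + x * z ^+ 2 * (s2 ^+ 2 - 2 * s1)
  + y ^+ 3 + y ^+ 2 * z * s1 + y * z ^+ 2 * s2 + z ^+ 3.

Lemma norm_formE {R : realType} {b : R} {a : R[i]} {s1 s2} w :
  complex_cubic_unit b a s1 s2 ->
  (norm_form s1 s2 w)%:~R = quad w b * sqnorm (quad w a).
Proof.
case: a => r s h; have := ccu_prod h; have := ccu_sum h; have := ccu_sum2 h.
rewrite /sqnorm /= => e2 e1 e3; rewrite /norm_form !quadE.
pose x := w ord0; pose y := w (@Ordinal 3 1 isT).
pose z := w (@Ordinal 3 2 isT); rewrite -/x -/y -/z.
have intrC n : n%:~R = (n%:~R : R)%:C by rewrite rmorph_int.
rewrite !intrC /= !(intrD, intrM, intrN, rmorphXn) /= e1 e2.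
pose X : R := x%:~R; pose Y : R := y%:~R; pose Z : R := z%:~R.
rewrite -/X -/Y -/Z.
set n := r ^+ 2 + s ^+ 2 in e3 *.
(* The factors [b * n = 1] restore the homogeneous norm form, which is an
   identity in [b], [r] and [s]. *)
transitivity (X ^+ 3 + X ^+ 2 * Y * (b + 2 * r)
  + X ^+ 2 * Z * ((b + 2 * r) ^+ 2 - 2 * (2 * b * r + n))
  + X * Y ^+ 2 * (2 * b * r + n)
  + X * Y * Z * ((b + 2 * r) * (2 * b * r + n) - 3 * (b * n))
  + X * Z ^+ 2 * ((2 * b * r + n) ^+ 2 - 2 * (b + 2 * r) * (b * n))
  + Y ^+ 3 * (b * n) + Y ^+ 2 * Z * (b + 2 * r) * (b * n)
  + Y * Z ^+ 2 * (2 * b * r + n) * (b * n) + Z ^+ 3 * (b * n) ^+ 2).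
  by rewrite e3; ring.
by rewrite /n; ring.
Qed.

Lemma gp_int_norm_form {R : realType} s1 s2 (w : 'I_3 -> nat -> int) :
  (forall i, gp_int R (w i)) ->
  gp_int R (fun n => norm_form s1 s2 (w^~ n)).
Proof.
move=> hw; rewrite /norm_form.
by repeat first [ exact: hw | apply: gp_int_cst | apply: gp_intB
                | apply: gp_intD | apply: gp_intX | apply: gp_intM ].
Qed.

Lemma gp_map_nat_quad {R : realType} (b : R) (w : 'I_3 -> nat -> int) :
  (forall i, gp_int R (w i)) -> gp_map_nat (fun n => quad (w^~ n) b).
Proof.
move=> hw; have hb c := @gp_map_nat_cst R c.
apply: gp_map_nat_ext (gp_map_natD (gp_map_natD (hw ord0)
  (gp_map_natM (hw (@Ordinal 3 1 isT)) (hb b)))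
  (gp_map_natM (hw (@Ordinal 3 2 isT)) (hb (b ^+ 2)))) => n.
by rewrite quadE.
Qed.

Lemma congz_quad {R : realType} (b : R) (M : nat) (v c : 'I_3 -> int) :
  (0 < M)%N -> [forall i, (M %| v i - c i)%Z] ->
  congz b M (quad v b) (quad c b).
Proof.
move=> M0 /forallP vc; have M_neq0 : M%:R != 0 :> R by rewrite pnatr_eq0 -lt0n.
have /choice[q qE] i : exists q, v i - c i = q * M%:Z by exact/dvdzP.
rewrite /congz; suff -> : quad v b - quad c b = quad q b * M%:R.
  by rewrite mulfK//; exact: in_order_quad.
rewrite /quad -sumrB mulr_suml; apply: eq_bigr => i _.
by rewrite -mulrBl -intrB qE intrM mulrAC.
Qed.

(** [n] belongs to the set if and only if it is nonzero and some offset [t] in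
    the box yields a candidate of norm one, nearest to [n], and congruent to
    some [b^j].  A candidate passing the tests is [b^k] with [k] an integer of
    any sign; for negative [k] it lies below 1, so [n = 1], which is the integer
    nearest to [b^0]. *)
Lemma nearest_powers_gp {R : realType} {b : R} {a : R[i]} {s1 s2} :
  complex_cubic_unit b a s1 s2 ->
  exists2 P, gp_test R P & forall n, P n <-> nearest_powers b n.
Proof.
move=> h; have b0 := ccu_pos h; have b1 := ccu_gt1 h.
have irr := ccu_irrational h.
have [d [C hC]] := coord_approx h.
have [[//|M] M0 hM] := power_congruence h.
(* The true coordinates differ from [floor (d i * n)] by less than [K]; offsets
   in the range from [-K] to [K] are stored as ordinals shifted by [K]. *)
pose K := (Num.truncn (C + \sum_i `|d i| + 1)).+1.
pose w (t : {ffun 'I_3 -> 'I_(K.*2).+1}) i n : int :=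
  Num.floor (d i * n%:R) + (t i)%:Z - K%:Z.
pose Q t n := [&& norm_form s1 s2 ((w t)^~ n) - 1 == 0,
  nearest_int (quad ((w t)^~ n) b) - n%:Z == 0
  & [exists c : {ffun 'I_3 -> 'I_M.+1},
      `[< exists j : nat, congz b M.+1 (quad (fun i => (c i)%:Z) b) (b ^+ j) >]
      && [forall i, (M.+1 %| w t i n - (c i)%:Z)%Z]]].
exists (fun n => ~~ (n%:Z == 0) && [exists t, Q t n]).
  have hw t i : gp_int R (w t i).
    apply: gp_intB (gp_int_cst _ _); apply: gp_intD (gp_int_cst _ _).
    exact: gp_int_floor (gp_map_natZ _ (gp_map_nat_id R)).
  apply: gp_test_and.
    by apply: gp_test_not; apply: gp_test_eq0 irr _; exact: gp_int_id.
  apply: gp_test_exists => t; apply: gp_test_and.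
    apply: gp_test_eq0 irr _; apply: gp_intB (gp_int_cst _ _).
    exact: gp_int_norm_form (hw t).
  apply: gp_test_and.
    apply: gp_test_eq0 irr _; apply: gp_intB (gp_int_id _).
    apply: gp_int_floor; apply: gp_map_natD (gp_map_nat_cst _).
    exact: gp_map_nat_quad.
  apply: gp_test_exists => c; apply: gp_test_and; first exact: gp_test_cst.
  apply: gp_test_forall => i; apply: gp_test_dvd irr M0 _.
  exact: gp_intB (hw t i) (gp_int_cst _ _).
move=> n; split.
  move=> /andP[n0 /existsP[t /and3P[N1 Ln /existsP[c /andP[]]]]].
  move=> /asboolP[j cj] cw.
  move: N1 Ln; rewrite !subr_eq0 => /eqP N1 /eqP Ln.
  set v := (w t)^~ n in N1 Ln cw.
  have vN : quad v b * sqnorm (quad v a) = 1 by rewrite -(norm_formE v h) N1.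
  have n1 : 1 <= n%:R :> R by rewrite ler1n lt0n.
  have /andP[f1 f2] := floor_itv (quad v b + 2^-1).
  rewrite -/(nearest_int _) Ln -pmulrn in f1.
  rewrite -/(nearest_int _) Ln intrD -pmulrn in f2.
  have v0 : 0 < quad v b by lra.
  have vj : congz b M.+1 (quad v b) (b ^+ j).
    have vc := congz_quad b M.+1 v (fun i => (c i)%:Z) M0 cw.
    exact: congz_trans vc cj.
  rewrite !quad_zeval in vN v0 vj.
  have [[k|k] kE] := hM _ v0 vN j vj; rewrite -quad_zeval in kE.
    by exists k; rewrite -[b ^+ k]/(b ^ k%:Z) -kE.
  exists 0%N; rewrite expr0; apply: floor_def.
  have : quad v b < 1.
    by rewrite kE NegzE -exprnN invf_lt1 ?exprn_egt1// exprn_gt0.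
  move=> lt1; have n_eq1 : n = 1%N.
    apply/eqP; rewrite eqn_leq lt0n n0 andbT -ltnS -(ltr_nat R); lra.
  rewrite n_eq1 intrD; lra.
move=> [i iE].
have bi1 : 1 <= b ^+ i by rewrite exprn_ege1// ltW.
have /andP[f1 f2] := floor_itv (b ^+ i + 2^-1).
rewrite -/(nearest_int _) iE -pmulrn in f1.
rewrite -/(nearest_int _) iE intrD -pmulrn in f2.
apply/andP; split.
  by apply: contraTneq bi1 => -[n0]; rewrite n0 in f2; rewrite -ltNge; lra.
have [v vE] := zeval_reduce s1 s2 ('X ^+ i).
have := vE _ _ (ccu_cubic h); have := vE _ _ (ccu_conj_cubic h).
rewrite !zevalXn !zevalX => va vb.
have ai1 : sqnorm (quad v a) <= 1.
  have := ccu_norm_exprz i%:Z h; rewrite -!exprnP va => <-.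
  by rewrite ler_peMl// addr_ge0 ?sqr_ge0.
have near k : (`|v k - Num.floor (d k * n%:R)| < K)%N.
  rewrite -(ltr_nat R) natr_absz intr_norm.
  apply: le_lt_trans (truncnS_gt _).
  have dk : `|d k| <= \sum_i `|d i|.
    by rewrite (bigD1 k)//= ler_wpDr ?sumr_ge0.
  have bn : `|b ^+ i - n%:R| <= 1 by rewrite ler_norml; apply/andP; split; lra.
  have fl : `|d k * n%:R - (Num.floor (d k * n%:R))%:~R| <= 1.
    have /andP[g1 g2] := floor_itv (d k * n%:R); rewrite intrD in g2.
    by rewrite ler_norml; apply/andP; split; lra.
  rewrite intrB.
  have -> : (v k)%:~R - (Num.floor (d k * n%:R))%:~R =
      ((v k)%:~R - d k * quad v b) + d k * (b ^+ i - n%:R)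
      + (d k * n%:R - (Num.floor (d k * n%:R))%:~R) :> R by rewrite -vb; ring.
  rewrite (le_trans (ler_normD _ _))// lerD// (le_trans (ler_normD _ _))//.
  rewrite lerD ?hC// normrM (le_trans _ dk)// ler_piMr//.
apply/existsP.
exists [ffun k => inord (absz (v k - Num.floor (d k * n%:R) + K%:Z))].
set t := finfun _.
have tE : (w t)^~ n = v.
  apply: funext => k; rewrite /w ffunE inordK; have := near k; lia.
rewrite /Q tE subr_eq0 subr_eq0 -vb iE eqxx andTb; apply/andP; split.
  apply/eqP; apply: (@intr_inj R).
  by rewrite (norm_formE v h) -va -vb (ccu_norm_exprz i%:Z h).
have residue_lt (x : int) : 0 <= (x %% M.+1)%Z < M.+1%:Z.
  by rewrite modz_ge0 // ltz_pmod.
pose c : {ffun 'I_3 -> 'I_M.+1} := [ffun k => inord (absz (v k %% M.+1)%Z)].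
have cE k : (c k)%:Z = (v k %% M.+1)%Z.
  by rewrite ffunE inordK; have := residue_lt (v k); lia.
have vc k : (M.+1 %| v k - (c k)%:Z)%Z.
  by rewrite cE [X in X - _](divz_eq _ M.+1) addrK dvdz_mull ?dvdzz.
apply/existsP; exists c; apply/andP; split; last first.
  by apply/forallP => k; rewrite (congr1 (@^~ k) tE : w t k n = v k).
apply/asboolP; exists i; rewrite vb; apply: congz_sym.
by apply: congz_quad => //; apply/forallP.
Qed.

Theorem theorem10p2 (R : realType) (beta : R) (alpha : R[i])
    (hbeta : cubic_pisot_unit beta)
    (halpha : galois_conjugate beta alpha)
    (halpha_conj : galois_conjugate beta (alpha^*))
    (halpha_nonreal : complex.Im alpha != 0) :
  bracket_word R (char_word (nearest_powers beta)).
Proof.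
have [s1 [s2 h]] :=
  cubic_pisot_unit_data _ _ _ hbeta halpha halpha_conj halpha_nonreal.
have [P hP PE] := nearest_powers_gp h.
exists (fun n => (P n)%:R), (fun x => if x == 1 then 1 else 0); split=> //.
  apply: (@sub_finite_set _ _ [set 0; 1]%classic) => //.
  by move=> _ [n _ <-]; case: (P n); [right|left].
move=> n; rewrite /char_word /indic.
have -> : (n \in nearest_powers beta) = P n.
  by apply/idP/idP => [/set_mem/PE//|/PE/mem_set].
by case: (P n); rewrite ?eqxx// eq_sym oner_eq0.
Qed.
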